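(* Let $n\ge2$ and consider the most general equation of degree $n$ with alternating Galois group, i.e. the equation $$f(x)=x^n+a_1x^{n-1}+\cdots+a_n=0$$ with $a_1,\dots,a_n$ independent variables, over the field $K=\mathbb{C}(a_1,\dots,a_n,z)$, where $z^2=D(a_1,\dots,a_n)$ and $D$ is the discriminant of $f$. Then every rational resolvent of this equation contains at least $$\left[\frac{n-1}{2}\right]$$ parameters.
   Context: $[\,\cdot\,]$ denotes the integer part. Let $x_1,\dots,x_n$ be the roots of $f$ in an algebraic closure of $K$. Rational resolvent: an equation $g(y)=0$ of degree $n$ without multiple roots $y_1,\dots,y_n$, whose coefficients are rational functions (over $\mathbb{C}$) of $s$ parameters $v_1,\dots,v_s$, where each $v_j$ is an entire rational function of the parameters of $f$ (a polynomial in $a_1,\dots,a_n,z$ with complex coefficients), such that the roots, suitably numbered, are related by $$y_i=\alpha_0+\alpha_1x_i+\cdots+\alpha_{n-1}x_i^{n-1}\quad(i=1,\dots,n),\qquad \alpha_0,\dots,\alpha_{n-1}\in K.$$ The number $s$ is the number of parameters of the resolvent. *)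

(* Defs.v *)
From HB Require Import structures.
From mathcomp Require Import all_boot all_order all_algebra all_field.
From mathcomp Require Import reals complex mpoly.

Set Implicit Arguments.
Unset Strict Implicit.
Unset Printing Implicit Defensive.

Import GRing.Theory.
Local Open Scope ring_scope.

(* C(a_1, ..., a_n) with a_1, ..., a_n independent variables.  The complex
   numbers are R[i] for a complete archimedean ordered field R. *)
Definition ratFun (R : realType) (n : nat) : fieldType :=
  {fraction {mpoly (complex R)[n]}}.

Section Resolvent.
Variables (R : realType) (n : nat).

(* Indices are shifted by one: genVar i is a_(i+1). *)
Definition genVar (i : 'I_n) : ratFun R n := tofrac ('X_i : {mpoly (complex R)[n]}).

(* x^n + a_1 x^(n-1) + ... + a_n *)
Definition genPoly : {poly ratFun R n} :=
  'X^n + \sum_(i < n) genVar i *: 'X^(n - i.+1).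

Variable K : fieldExtType (ratFun R n).

Definition constK (c : complex R) : K := (tofrac (c%:MP : {mpoly (complex R)[n]}))%:A.

(* The family (a_1, ..., a_n, z) of elements of K. *)
Definition parsOf (z : K) (i : 'I_n.+1) : K :=
  if unlift ord_max i is Some k then (genVar k)%:A else z.

(* The value P(w_1, ..., w_m) in K of a polynomial P over C. *)
Definition evalK (m : nat) (w : 'I_m -> K) (P : {mpoly (complex R)[m]}) : K :=
  mmap constK w P.

(* v is a polynomial in a_1, ..., a_n, z with complex coefficients. *)
Definition entireRational (z v : K) : Prop :=
  exists P : {mpoly (complex R)[n.+1]}, v = evalK (parsOf z) P.

(* c is the value at v_1, ..., v_s of a rational function over C. *)
Definition rationalIn (s : nat) (v : 'I_s -> K) (c : K) : Prop :=
  exists P Q : {mpoly (complex R)[s]}, evalK v Q != 0 /\ c = evalK v P / evalK v Q.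

(* g(y) = 0 is a rational resolvent, with parameters v_1, ..., v_s, of the
   equation over K = C(a_1, ..., a_n, z) whose roots in L are x_1, ..., x_n.
   The parameters need not be algebraically independent. *)
Definition rationalResolvent (z : K) (L : fieldType) (j : {rmorphism K -> L})
    (x : 'I_n -> L) (s : nat) (v : 'I_s -> K) (g : {poly K}) : Prop :=
  [/\ forall k, entireRational z (v k),
      forall k, rationalIn v g`_k,
      size g = n.+1
    & exists (y : 'I_n -> L) (alpha : 'I_n -> K),
        [/\ map_poly j g = j (lead_coef g) *: \prod_i ('X - (y i)%:P),
            injective y
          & forall i, y i = \sum_(k < n) j (alpha k) * x i ^+ k]].

End Resolvent.

Definition prodSqDiff (L : fieldType) (n : nat) (x : 'I_n -> L) : L :=
  \prod_(i < n) \prod_(k < n | (i < k)%N) (x i - x k) ^+ 2.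

(* Main.v *)
Require Import Defs.
From HB Require Import structures.
From mathcomp Require Import all_boot all_order all_fingroup all_algebra all_field.
From mathcomp Require Import reals complex mpoly ring zify.

Set Implicit Arguments.
Unset Strict Implicit.
Unset Printing Implicit Defensive.

Import Order.Theory GRing.Theory Num.Theory.
Local Open Scope ring_scope.

(** The roots [x i] are algebraically independent over the complex field C, so
the situation takes place inside C(x): the parameters become polynomials in
[x], and the roots of the resolvent become fractions [Y i / q] of polynomials
on which every even permutation [t] acts by [Y i -> Y (t i)].

Let [k = n / 4], choose [k] disjoint blocks of four indices, and let a Klein
four-group act on each block by double transpositions.  The stronger bound
[2 * k < s] holds for [n > 2] ([resolvent_bound]).  Two facts give it.

- Every C-derivation of C[x] that kills the parameters kills the roots
  [Y i / q] of the resolvent, because these are simple roots of a polynomial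
  with coefficients in C(v) ([derivation_simple_root]).  If there were at most
  [2 * k] parameters, then among any [2 * k + 1] derivations some nontrivial
  combination would kill all parameters ([syzygy]), hence also every fraction
  built from parameters and roots.

- For suitable derivations this is impossible.  In coordinates where the Klein
  groups act by signs, take the Euler derivation and, for each block, two
  partial Euler derivations [theta A].  On each block form the sums [E b d] of
  the four [Y i] twisted by the three nontrivial characters [d] of the Klein
  group.  A 3-cycle inside the block permutes these three sums, so they are
  nonzero and have the same degree ([mdeg_E]), while the sign action determines
  the parity of their leading exponents ([signChange_E1], [signChange_E2]).
  The logarithmic derivative of a fraction along [theta A] has as its leading
  coefficient the [A]-weight of its leading exponent.  For a nonconstant
  parameter, which has positive degree because it is a polynomial, and for the
  [2 * k] quotients of degree zero of the sums [E b d], the matrix of these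
  weights has first column (positive degree, 0, ..., 0) and the identity
  modulo 2 as its remaining block.  So it is invertible ([det_mod2]), and the
  logarithmic derivatives are independent ([logTheta_free]).

Some parameter is nonconstant, since otherwise the roots of the resolvent would
be complex constants, which the even permutations cannot permute.  Finally
[2 * (n / 4) + 1] is at least [(n - 1) / 2]. *)

(** * Partial Euler derivations and leading exponents *)

Section LogDerivative.

Variables (C : numFieldType) (n : nat).
Implicit Types (A : {set 'I_n}) (m : 'X_{1..n}) (p q : {mpoly C[n]}).

Definition wt A m : nat := (\sum_(i in A) m i)%N.

(** The Euler derivation in the variables of [A]: monomials are eigenvectors, with
eigenvalue their [A]-weight ([thetaX]). *)
Definition theta A p : {mpoly C[n]} := \sum_(i in A) 'X_i * p^`M(i).

Arguments wt : simpl never.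
Arguments theta : simpl never.

Lemma wtT m : wt setT m = mdeg m.
Proof. by rewrite /wt mdegE; apply: eq_bigl => i; rewrite inE. Qed.

Lemma theta_is_linear A : linear (theta A).
Proof.
move=> c p q; rewrite /theta scaler_sumr -big_split; apply: eq_bigr => i _ /=.
by rewrite mderivD mderivZ mulrDr scalerAr.
Qed.

HB.instance Definition _ A :=
  GRing.isLinear.Build C {mpoly C[n]} {mpoly C[n]} _ (theta A)
    (theta_is_linear A).

Lemma thetaM A p q : theta A (p * q) = theta A p * q + p * theta A q.
Proof.
rewrite /theta mulr_suml mulr_sumr -big_split; apply: eq_bigr => i _ /=.
by rewrite mderivM mulrDr [in RHS]mulrCA !mulrA.
Qed.

Lemma thetaC A c : theta A c%:MP = 0.
Proof. by rewrite /theta big1 // => i _; rewrite mderivC mulr0. Qed.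

Lemma thetaX A m : theta A 'X_[m] = (wt A m)%:R *: 'X_[m].
Proof.
rewrite /theta /wt natr_sum scaler_suml; apply: eq_bigr => i _.
rewrite mderivX -scalerAr; case: (posnP (m i)) => [->|mi_gt0].
  by rewrite !scale0r.
congr (_ *: _); rewrite -mpolyXD addmC submK //.
by apply/mnm_lepP => j; rewrite mnm1E; case: eqP => [<-|] //.
Qed.

Lemma mcoeff_theta A p m : (theta A p)@_m = (wt A m)%:R * p@_m.
Proof.
rewrite [p in theta _ p]mpolyE (raddf_sum (theta A)) /= (raddf_sum (mcoeff m)).
rewrite [p in RHS]mpolyE (raddf_sum (mcoeff m)) /= mulr_sumr; apply: eq_bigr => k _.
rewrite linearZ /= thetaX !mcoeffZ mcoeffX mulrCA.
by case: eqP => [->|_]; rewrite ?mulr0.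
Qed.

Lemma mlead_theta A p : (mlead (theta A p) <= mlead p)%O.
Proof.
have [->|nz] := eqVneq (theta A p) 0; first by rewrite mlead0 le0x.
apply: msupp_le_mlead; rewrite mcoeff_msupp.
move: nz; rewrite -mleadc_eq0 mcoeff_theta; apply: contraNneq => ->.
by rewrite mulr0.
Qed.

(** The derivative of [p / q] along [theta A], multiplied by [q ^+ 2]; up to the
factor [p * q] it is the logarithmic derivative of [p / q]. *)
Definition logTheta A p q := theta A p * q - p * theta A q.

Lemma mlead_logTheta A p q :
  (mlead (logTheta A p q) <= (mlead p + mlead q)%MM)%O.
Proof.
rewrite (le_trans (mleadB_le _ _)) // leUx.
by apply/andP; split; rewrite (le_trans (mleadM_le _ _)) //;
  rewrite lem_add ?mlead_theta.
Qed.

Lemma mcoeff_logTheta A p q :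
  (logTheta A p q)@_(mlead p + mlead q) =
  ((wt A (mlead p))%:Z - (wt A (mlead q))%:Z)%:~R * (mleadc p * mleadc q).
Proof.
rewrite mcoeffB !mleadcMW ?mlead_theta // !mcoeff_theta.
by rewrite rmorphB /= mulrBl -mulrA [mleadc p * (_ * _)]mulrCA.
Qed.

(** In a relation with coefficients [p l], only those [p l] whose leading exponent
is maximal contribute to the top coefficient of each equation.  These top
coefficients form a linear system over [C] whose matrix, up to nonzero factors
on the rows, is the weight matrix. *)
Lemma logTheta_free r (A : 'I_r -> {set 'I_n}) (N M : 'I_r -> {mpoly C[n]}) :
    (forall i, N i != 0) -> (forall i, M i != 0) ->
    \det (\matrix_(i, l) ((wt (A l) (mlead (N i)))%:Z
                          - (wt (A l) (mlead (M i)))%:Z)) != 0 ->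
  forall p : 'I_r -> {mpoly C[n]},
    (forall i, \sum_l p l * logTheta (A l) (N i) (M i) = 0) ->
  forall l, p l = 0.
Proof.
move=> nzN nzM detL p rel.
case: (pickP (fun l => p l != 0)) => [l0 nzl0|z l]; last by apply/eqP/negbFE/z.
case: (@arg_maxP _ _ _ l0 (fun l => p l != 0) (fun l => mlead (p l)) nzl0) =>
  l1 nzl1 max_l1.
pose top := mlead (p l1).
have le_top l : (mlead (p l) <= top)%O.
  have [->|nz] := eqVneq (p l) 0; last exact: max_l1.
  by rewrite mlead0 le0x.
pose c : 'cV[C]_r := \col_l (p l)@_top.
pose L := \matrix_(i, l) ((wt (A l) (mlead (N i)))%:Z
                          - (wt (A l) (mlead (M i)))%:Z).
have nzL : \det (map_mx intr L : 'M[C]_r) != 0.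
  by rewrite det_map_mx intr_eq0.
have Lc : map_mx intr L *m c = 0.
  apply/matrixP => i j; rewrite !mxE.
  have nzlc : mleadc (N i) * mleadc (M i) != 0.
    by rewrite mulf_neq0 ?mleadc_eq0.
  apply: (mulfI nzlc); rewrite mulr0 mulr_sumr.
  have := congr1 (mcoeff (top + (mlead (N i) + mlead (M i)))%MM) (rel i).
  rewrite mcoeff0 raddf_sum /= => rel_i; rewrite -[RHS]rel_i.
  apply: eq_bigr => l _.
  rewrite mleadcMW ?mlead_logTheta // mcoeff_logTheta !mxE.
  by rewrite [LHS]mulrC -[LHS]mulrA [LHS]mulrCA.
have c0 : c = 0.
  have uL : (map_mx intr L : 'M[C]_r) \in unitmx by rewrite unitmxE unitfE.
  by rewrite -(mulKmx uL c) Lc mulmx0.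
move/matrixP/(_ l1 0): c0; rewrite !mxE => /eqP.
by rewrite mleadc_eq0 (negPf nzl1).
Qed.

End LogDerivative.

(** * Linear algebra over the integers modulo 2 and over a domain *)

(** The expansion along the first column leaves one minor, which is odd. *)
Lemma det_mod2 r (M : 'M[int]_r.+1) :
    M ord0 ord0 != 0 -> (forall i, M (lift ord0 i) ord0 = 0) ->
    (forall i j, (M (lift ord0 i) (lift ord0 j))%:~R = (i == j)%:R :> 'F_2) ->
  \det M != 0.
Proof.
move=> M00 Mi0 Mij; rewrite (expand_det_col M ord0) big_ord_recl big1 ?addr0.
  rewrite mulf_neq0 // /cofactor expr0 mul1r.
  have det1 : \det (map_mx intr (row' ord0 (col' ord0 M)) : 'M['F_2]_r) = 1.
    apply: etrans (det1 _ r); congr (\det _); apply/matrixP => i j.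
    by rewrite !mxE; apply: Mij.
  by apply: contra_eq_neq det1 => det0; rewrite det_map_mx det0 eq_sym oner_neq0.
by move=> i _; rewrite Mi0 mul0r.
Qed.

Lemma frac_denom (A : idomainType) (f : {fraction A}) :
  exists2 b, b != 0 & exists a, f * tofrac b = tofrac a.
Proof.
elim/quotW: f => x; exists (frac x).2; first exact: denom_ratioP.
exists (frac x).1; rewrite -[LHS]/(FracField.mul _ _) !piE.
apply/eqmodP; rewrite /= FracField.equivfE /FracField.mulf.
by rewrite !numden_Ratio ?(oner_eq0, mulf_neq0, denom_ratioP) // !mulr1 mulrC.
Qed.

(** A vector in the kernel over the fraction field, cleared of denominators. *)
Lemma syzygy (A : idomainType) N s (B : 'I_N -> 'I_s -> A) : (s < N)%N ->
  exists2 p : 'I_N -> A, (exists l, p l != 0) & forall k, \sum_l p l * B l k = 0.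
Proof.
move=> ltsN; pose B' : 'M[{fraction A}]_(N, s) := \matrix_(l, k) tofrac (B l k).
have : kermx B' != 0.
  by rewrite -mxrank_eq0 mxrank_ker subn_eq0 -ltnNge (leq_ltn_trans (rank_leq_col _)).
case/rowV0Pn => u /sub_kermxP uB nz_u.
have [b nz_b /fin_all_exists[a ab]] :=
  fin_all_exists2 (fun l => frac_denom (u 0 l)).
pose p l := a l * \prod_(i | i != l) b i.
have pE l : tofrac (p l) = u 0 l * tofrac (\prod_i b i).
  rewrite tofracM -ab -mulrA -tofracM.
  by congr (_ * tofrac _); rewrite [RHS](bigD1 l).
have nz_prod : tofrac (\prod_i b i) != 0 :> {fraction A}.
  by rewrite tofrac_eq0; apply/prodf_neq0.
exists p => [|k].
  have [l nz_ul] : exists l, u 0 l != 0 by apply/rV0Pn.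
  by exists l; rewrite -tofrac_eq0 pE mulf_neq0.
apply/eqP; rewrite -tofrac_eq0 rmorph_sum /=; apply/eqP.
transitivity ((u *m B') 0 k * tofrac (\prod_i b i)); last first.
  by rewrite uB mxE mul0r.
rewrite mxE mulr_suml; apply: eq_bigr => l _.
by rewrite tofracM pE !mxE mulrAC.
Qed.

(** * Derivations and simple roots *)

(** One term of the derivation of a homogeneous form in [y] and [q], for abstract
values of the powers [P = y ^+ k], [P' = y ^+ k.-1], [Q = q ^+ l] and
[Q' = q ^+ l.-1]: the part along [y] and [q] jointly is Euler's identity. *)
Lemma euler_term (A : comNzRingType) (c P P' Q Q' q y dy dq k l : A) :
    P * k = P' * y * k -> q * Q' * l = Q * l ->
  q * (c * (P' * dy * k * Q + P * (Q' * dq * l))) =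
  c * (P' * Q) * k * (q * dy - y * dq) + c * (P * Q) * dq * (l + k).
Proof.
move=> Pk Ql.
transitivity (c * (P' * Q) * k * q * dy + c * P * dq * (q * Q' * l)); first ring.
rewrite Ql.
transitivity (c * (P' * Q) * k * q * dy - c * Q * dq * (P' * y * k)
              + c * Q * dq * (P * k) + c * (P * Q) * dq * l); last ring.
rewrite Pk; ring.
Qed.

Section Derivation.

Variables (A : idomainType) (D : A -> A).
Hypotheses (DD : forall a b, D (a + b) = D a + D b)
           (DM : forall a b, D (a * b) = D a * b + a * D b).

Lemma derivation0 : D 0 = 0.
Proof. by apply: (addrI (D 0)); rewrite -DD !addr0. Qed.

Lemma derivation_sum I (r : seq I) (F : I -> A) :
  D (\sum_(i <- r) F i) = \sum_(i <- r) D (F i).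
Proof.
by elim: r => [|i r IH]; rewrite ?big_nil ?derivation0 // !big_cons DD IH.
Qed.

Lemma derivation1 : D 1 = 0.
Proof. by apply: (addrI (D 1)); rewrite addr0 -[in RHS](mulr1 1) DM mulr1 mul1r. Qed.

Lemma derivationX a k : D (a ^+ k) = a ^+ k.-1 * D a *+ k.
Proof.
elim: k => [|k IH]; first by rewrite derivation1.
rewrite exprS DM IH /= mulrS [D a * _]mulrC; congr (_ + _).
by case: k {IH} => [|k]; rewrite ?mulr0n ?mulr0 // exprS mulrnAr mulrA.
Qed.

Lemma derivation_mmap (C : nzRingType) s (f : {rmorphism C -> A}) (V : 'I_s -> A) :
    (forall c, D (f c) = 0) -> (forall k, D (V k) = 0) ->
  forall P : {mpoly C[s]}, D (mmap f V P) = 0.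
Proof.
move=> Df DV P; rewrite /mmap derivation_sum big1 // => m _.
rewrite DM Df mul0r add0r /mmap1.
have -> : D (\prod_(i < s) V i ^+ m i) = 0; last by rewrite mulr0.
elim/big_rec: _ => [|i a _ IH]; first exact: derivation1.
by rewrite DM IH derivationX DV !mulr0 mul0rn mul0r addr0.
Qed.

(** Here [y / q] is a root of the polynomial with coefficients [c k], with
denominators cleared.  Applying [D] to the relation and using Euler's identity
gives the derivative of that polynomial at [y / q] times
[q * D y - y * D q], which therefore vanishes. *)
Lemma derivation_simple_root m (c : nat -> A) (y q : A) :
    (forall k, D (c k) = 0) ->
    \sum_(k < m.+1) c k * (y ^+ k * q ^+ (m - k)) = 0 ->
    \sum_(k < m) c k.+1 * (y ^+ k * q ^+ (m - k.+1)) *+ k.+1 != 0 ->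
  q * D y = y * D q.
Proof.
move=> Dc rel nz; apply/eqP; rewrite -subr_eq0.
move: nz; apply: contraNT => nz; apply/eqP; apply: (mulIf nz).
rewrite mul0r mulr_suml.
have key k : (k <= m)%N ->
    q * D (c k * (y ^+ k * q ^+ (m - k))) =
    (c k * (y ^+ k.-1 * q ^+ (m - k)) *+ k) * (q * D y - y * D q)
    + c k * (y ^+ k * q ^+ (m - k)) * D q *+ m.
  move=> lekm; rewrite !DM Dc mul0r add0r !derivationX.
  have : m = (m - k + k)%N by rewrite subnK.
  move: (m - k)%N => l ->; rewrite -!(mulr_natr (_ * _)) natrD; apply: euler_term.
    by case: k {lekm} => [|k]; rewrite ?mulr0 // exprSr.
  by case: l => [|l]; rewrite ?mulr0 // exprS.
have: q * D (\sum_(k < m.+1) c k * (y ^+ k * q ^+ (m - k))) = 0.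
  by rewrite rel derivation0 mulr0.
rewrite derivation_sum mulr_sumr.
rewrite (eq_bigr _ (fun k _ => key (val k) (leq_ord k))) big_split /=.
rewrite [X in _ + X]sumrMnl -[X in _ + X *+ m]mulr_suml rel mul0r mul0rn addr0 => sum0.
rewrite -[RHS]sum0 big_ord_recl /= mulr0n mul0r add0r.
by apply: eq_bigr.
Qed.

End Derivation.

(** * A lower bound for the number of parameters *)

Section Independence.

Variables (C : numFieldType) (n : nat).

(** With fewer than [r] parameters there is a nontrivial combination of the
derivations [theta (A l)] that kills all parameters; by hypothesis it then
kills the fractions [N i / M i], against [logTheta_free]. *)
Lemma parameter_bound s r (V : 'I_s -> {mpoly C[n]}) (A : 'I_r -> {set 'I_n})
    (N M : 'I_r -> {mpoly C[n]}) :
    (forall i, N i != 0) -> (forall i, M i != 0) ->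
    \det (\matrix_(i, l) ((wt (A l) (mlead (N i)))%:Z
                          - (wt (A l) (mlead (M i)))%:Z)) != 0 ->
    (forall D : {mpoly C[n]} -> {mpoly C[n]},
       (forall a b, D (a + b) = D a + D b) ->
       (forall a b, D (a * b) = D a * b + a * D b) ->
       (forall c, D c%:MP = 0) -> (forall k, D (V k) = 0) ->
     forall i, D (N i) * M i = N i * D (M i)) ->
  (r <= s)%N.
Proof.
move=> nzN nzM detL killed; rewrite leqNgt; apply/negP => ltsr.
have [p [l nz_pl] relV] := syzygy (fun l k => theta (A l) (V k)) ltsr.
have [] := negP nz_pl; apply/eqP; apply: (logTheta_free nzN nzM detL) => i.
pose D f := \sum_l p l * theta (A l) f.
have D_N : D (N i) * M i = N i * D (M i).
  apply: killed => [a b|a b|c|k]; rewrite /D.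
  - by rewrite -big_split; apply: eq_bigr => j _; rewrite raddfD mulrDr.
  - rewrite mulr_suml mulr_sumr -big_split; apply: eq_bigr => j _ /=.
    by rewrite thetaM mulrDr mulrA [a * (p j * _)]mulrCA.
  - by rewrite big1 // => j _; rewrite thetaC mulr0.
  - exact: relV.
move/eqP: D_N; rewrite -subr_eq0 /D mulr_suml mulr_sumr -sumrB => /eqP rel_i.
rewrite -[RHS]rel_i; apply: eq_bigr => j _.
by rewrite /logTheta mulrBr mulrA [p j * (N i * _)]mulrCA.
Qed.

End Independence.

(** * Substitutions in polynomials *)

Section Morphisms.

Lemma eq_mpoly_morph (n : nat) (C S : comNzRingType) (f g : {rmorphism {mpoly C[n]} -> S}) :
    (forall c, f c%:MP = g c%:MP) -> (forall i, f 'X_i = g 'X_i) -> f =1 g.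
Proof.
move=> fgC fgX p; rewrite [p]mpolyE !raddf_sum; apply: eq_bigr => m _ /=.
rewrite -mul_mpolyC !rmorphM fgC; congr (_ * _).
rewrite mpolyXE_id !rmorph_prod; apply: eq_bigr => i _.
by rewrite !rmorphXn /= fgX.
Qed.

Lemma rmorph_mmap (s : nat) (C S T : comNzRingType) (f : {rmorphism S -> T})
    (g : {rmorphism C -> S}) (V : 'I_s -> S) (P : {mpoly C[s]}) :
  f (mmap g V P) = mmap (f \o g) (f \o V) P.
Proof.
rewrite /mmap rmorph_sum; apply: eq_bigr => m _; rewrite rmorphM; congr (_ * _).
by rewrite /mmap1 rmorph_prod; apply: eq_bigr => i _; rewrite rmorphXn.
Qed.

End Morphisms.

Lemma msize_msym n (C : nzRingType) (t : 'S_n) (P : {mpoly C[n]}) :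
  msize (msym t P) = msize P.
Proof.
have le u (Q : {mpoly C[n]}) : (msize (msym u Q) <= msize Q)%N.
  rewrite [leqLHS]msizeE; apply/bigmax_leqP_seq => m m_in _.
  rewrite -(mdeg_mperm m u); apply: msize_mdeg_lt.
  by rewrite mcoeff_msupp -mcoeff_sym -mcoeff_msupp.
apply/eqP; rewrite eqn_leq le /= -[leqLHS](congr1 _ (msym1m P)) -(mulgV t).
by rewrite msymMm.
Qed.

(** * Sign changes and parity of leading exponents *)

Section SignChange.

Variables (C : numFieldType) (n : nat).
Implicit Types (A : {set 'I_n}) (p : {mpoly C[n]}).

Definition signChange A : {mpoly C[n]} -> {mpoly C[n]} :=
  comp_mpoly [tuple (-1) ^+ (i \in A) *: 'X_i | i < n].

HB.instance Definition _ A := GRing.RMorphism.on (signChange A).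

Lemma signChangeC A c : signChange A c%:MP = c%:MP.
Proof. exact: comp_mpolyC. Qed.

Lemma signChangeZ A c p : signChange A (c *: p) = c *: signChange A p.
Proof. exact: comp_mpolyZ. Qed.

Lemma signChangeXi A i : signChange A 'X_i = (-1) ^+ (i \in A) *: 'X_i.
Proof. by rewrite /signChange comp_mpolyXU -tnth_nth tnth_mktuple. Qed.

Lemma signChangeX A m : signChange A 'X_[m] = (-1) ^+ wt A m *: 'X_[m].
Proof.
rewrite mpolyXE_id rmorph_prod /wt -prodrXr [\prod_(i in A) _]big_mkcond /=.
rewrite -scaler_prod; apply: eq_bigr => i _.
rewrite rmorphXn /= signChangeXi exprZn -exprM; congr (_ *: _).
by case: (i \in A); rewrite ?mul1n ?mul0n ?expr1n.
Qed.

Lemma mcoeff_signChange A p m : (signChange A p)@_m = (-1) ^+ wt A m * p@_m.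
Proof.
rewrite [p in signChange _ p]mpolyE (raddf_sum (signChange A)) /=.
rewrite (raddf_sum (mcoeff m)) [p in RHS]mpolyE (raddf_sum (mcoeff m)) /=.
rewrite mulr_sumr; apply: eq_bigr => k _.
rewrite -mul_mpolyC rmorphM /= signChangeC signChangeX !mcoeffCM mcoeffZ mcoeffX.
by rewrite mulrCA; case: eqP => [->|_]; rewrite ?mulr0.
Qed.

(** A sign change acts on each monomial by the parity of its weight, so all the
monomials of an eigenvector have the same parity. *)
Lemma odd_wt_mlead A p (b : bool) :
  p != 0 -> signChange A p = (-1) ^+ b *: p -> odd (wt A (mlead p)) = b.
Proof.
move=> nz_p /(congr1 (mcoeff (mlead p))).
rewrite mcoeff_signChange mcoeffZ => /mulIf eq_sign.
have /eqP : (-1) ^+ wt A (mlead p) = (-1) ^+ b :> C.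
  by apply: eq_sign; rewrite mleadc_eq0.
rewrite -signr_odd; case: odd; case: b {eq_sign} => //.
  by rewrite expr0 expr1 eqNr oner_eq0.
by rewrite expr0 expr1 eq_sym eqNr oner_eq0.
Qed.

End SignChange.

(** * The Klein four-group *)

Local Notation o1 := (@Ordinal 4 1 isT).
Local Notation o2 := (@Ordinal 4 2 isT).
Local Notation o3 := (@Ordinal 4 3 isT).
Local Notation o0 := (@Ordinal 4 0 isT).

Lemma sum4 (M : nmodType) (F : 'I_4 -> M) :
  \sum_r F r = F o0 + F o1 + F o2 + F o3.
Proof.
rewrite !big_ord_recl big_ord0 addr0 !addrA.
by congr (F _ + F _ + F _ + F _); apply: val_inj.
Qed.

(** The pairing of [F_2^2] with itself, an index of ['I_4] being read as the pair
of its binary digits: [(-1) ^+ kleinChar r c] is the value at [c] of the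
character [r] of the Klein group. *)
Definition kleinChar (r c : 'I_4) : bool := (odd r && odd c) (+) ((1 < r)%N && (1 < c)%N).

(** Translation by [a] in [F_2^2], for [a] equal to [o1] or [o2]. *)
Definition kleinShift (a : 'I_4) : 'S_4 :=
  if a == o1 then (tperm o0 o1 * tperm o2 o3)%g
  else (tperm o0 o2 * tperm o1 o3)%g.

(** The cycle [1 -> 2 -> 3 -> 1], a linear map of [F_2^2] that is self-adjoint for
the pairing ([kleinChar_rot3]). *)
Definition rot3 : 'S_4 := (tperm o1 o2 * tperm o1 o3)%g.

Ltac ord4 r := case: r => [[|[|[|[|//]]]] ?].

Lemma kleinShift1E r : kleinShift o1 r = nth o0 [:: o1; o0; o3; o2] r.
Proof. by apply: val_inj; ord4 r; rewrite permM !permE. Qed.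

Lemma kleinShift2E r : kleinShift o2 r = nth o0 [:: o2; o3; o0; o1] r.
Proof. by apply: val_inj; ord4 r; rewrite permM !permE. Qed.

Lemma rot3E r : rot3 r = nth o0 [:: o0; o2; o3; o1] r.
Proof. by apply: val_inj; ord4 r; rewrite permM !permE. Qed.

Lemma kleinCharC r c : kleinChar r c = kleinChar c r.
Proof. by rewrite /kleinChar andbC [(1 < r)%N && _]andbC. Qed.

Lemma kleinChar_shift1 r c : kleinChar (kleinShift o1 r) c = kleinChar r c (+) kleinChar o1 c.
Proof. by rewrite kleinShift1E; ord4 r; ord4 c. Qed.

Lemma kleinChar_shift2 r c : kleinChar (kleinShift o2 r) c = kleinChar r c (+) kleinChar o2 c.
Proof. by rewrite kleinShift2E; ord4 r; ord4 c. Qed.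

Lemma kleinChar_rot3 r c : kleinChar (rot3 r) c = kleinChar r (rot3 c).
Proof. by rewrite !rot3E; ord4 r; ord4 c. Qed.

(** The character table is a Hadamard matrix of order 4. *)
Lemma kleinChar_orthogonal (C : numFieldType) r c :
  \sum_d (-1) ^+ kleinChar r d * (-1) ^+ kleinChar d c = (r == c)%:R * 4 :> C.
Proof.
rewrite !big_ord_recl big_ord0.
ord4 r; ord4 c; rewrite /kleinChar /= /bump /= ?(expr0, expr1).
all: ring.
Qed.

(** * Coordinates in which the Klein groups act by signs *)

Section Blocks.

Variables (n k : nat) (pt : 'I_k * 'I_4 -> 'I_n).
Hypothesis pt_inj : injective pt.

Lemma pt_neq b r c : r != c -> pt (b, r) != pt (b, c).
Proof. by apply: contra_neq => /pt_inj[]. Qed.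

(** The permutation of ['I_n] that acts on block [b] as
[tperm a c * tperm d e].  This shape covers the elements of the Klein group as
well as [rot3], and it makes evenness visible. *)
Definition blockPerm (b : 'I_k) (a c d e : 'I_4) : 'S_n :=
  (tperm (pt (b, a)) (pt (b, c)) * tperm (pt (b, d)) (pt (b, e)))%g.

Lemma blockPerm_in b a c d e r :
  blockPerm b a c d e (pt (b, r)) = pt (b, (tperm a c * tperm d e)%g r).
Proof.
have ptb_inj : injective (fun r => pt (b, r)) by move=> x y /pt_inj[].
by rewrite !permM -!(inj_tperm _ _ _ ptb_inj).
Qed.

Lemma blockPerm_off b a c d e i :
  (forall r, i != pt (b, r)) -> blockPerm b a c d e i = i.
Proof. by move=> off; rewrite permM !tpermD // eq_sym. Qed.

Lemma blockPerm_even b a c d e : a != c -> d != e -> odd_perm (blockPerm b a c d e) = false.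
Proof. by move=> ac de; rewrite odd_permM !odd_tperm !pt_neq. Qed.

Variable C : numFieldType.
Implicit Types P : {mpoly C[n]}.

(** The variable of index [pt (b, r)] expressed in the new coordinates: on each
block the Hadamard transform of the four coordinates. *)
Definition hadamardForm (i : 'I_n) : {mpoly C[n]} :=
  if [pick p | pt p == i] is Some (b, r)
  then \sum_c (-1) ^+ kleinChar r c *: 'X_(pt (b, c)) else 'X_i.

Lemma hadamardForm_in b r :
  hadamardForm (pt (b, r)) = \sum_c (-1) ^+ kleinChar r c *: 'X_(pt (b, c)).
Proof.
rewrite /hadamardForm; case: pickP => [[b' r'] /eqP/pt_inj[-> ->] //|/(_ (b, r))].
by rewrite eqxx.
Qed.

Lemma hadamardForm_out i : (forall p, i != pt p) -> hadamardForm i = 'X_i.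
Proof.
move=> out; rewrite /hadamardForm; case: pickP => // p /eqP pt_p.
by case/eqP: (out p).
Qed.

Variant block_spec (i : 'I_n) : Type :=
  | InSome b r of i = pt (b, r)
  | OutAll of (forall p, i != pt p).

Lemma blockP i : block_spec i.
Proof.
case: (pickP (fun p => i == pt p)) => [[b r] /eqP|z]; first exact: InSome.
by apply: OutAll => p; rewrite z.
Qed.

Definition hadamardSubst : {mpoly C[n]} -> {mpoly C[n]} :=
  comp_mpoly [tuple hadamardForm i | i < n].

HB.instance Definition _ := GRing.RMorphism.on hadamardSubst.

Lemma hadamardSubstC c : hadamardSubst c%:MP = c%:MP.
Proof. exact: comp_mpolyC. Qed.

Lemma hadamardSubstX i : hadamardSubst 'X_i = hadamardForm i.
Proof. by rewrite /hadamardSubst comp_mpolyXU -tnth_nth tnth_mktuple. Qed.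

(** The Hadamard transform is its own inverse up to the factor 4. *)
Lemma hadamardSubst_inj : injective hadamardSubst.
Proof.
pose back := comp_mpoly [tuple if [pick p | pt p == i] is Some _
                               then 4^-1 *: hadamardForm i else 'X_i | i < n].
suff backK : cancel hadamardSubst back by apply: can_inj backK.
have backX i : back 'X_i = if [pick p | pt p == i] is Some _
                               then 4^-1 *: hadamardForm i else 'X_i.
  by rewrite /back comp_mpolyXU -tnth_nth tnth_mktuple.
have backZ c P : back (c *: P) = c *: back P by exact: comp_mpolyZ.
have back_sum (F : 'I_4 -> {mpoly C[n]}) : back (\sum_c F c) = \sum_c back (F c).
  exact: raddf_sum.
suff backKX i : back (hadamardSubst 'X_i) = 'X_i.
  apply: (eq_mpoly_morph (f := back \o hadamardSubst) (g := idfun)) => [c|i].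
    by rewrite [LHS](congr1 back (hadamardSubstC c)) [LHS]comp_mpolyC.
  exact: backKX.
rewrite hadamardSubstX; case: (blockP i) => [b r ->|out]; last first.
  rewrite hadamardForm_out // backX; case: pickP => // p /eqP pt_p.
  by case/eqP: (out p).
rewrite hadamardForm_in back_sum.
transitivity (\sum_c \sum_d (4^-1 * ((-1) ^+ kleinChar r c * (-1) ^+ kleinChar c d)) *:
               ('X_(pt (b, d)) : {mpoly C[n]})).
  apply: eq_bigr => c _; rewrite backZ backX.
  case: pickP => [_ _|/(_ (b, c))]; last by rewrite eqxx.
  rewrite hadamardForm_in !scaler_sumr; apply: eq_bigr => d _.
  by rewrite !scalerA mulrCA mulrA.
rewrite exchange_big /=.
under eq_bigr => d _ do rewrite -scaler_suml -mulr_sumr kleinChar_orthogonal.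
rewrite (bigD1 r) //= big1 => [|d dr]; last first.
  by rewrite eq_sym (negPf dr) mul0r mulr0 scale0r.
by rewrite addr0 eqxx mul1r mulVf ?scale1r // pnatr_eq0.
Qed.

Lemma hadamardSubst_equivariant (rho : {rmorphism {mpoly C[n]} -> {mpoly C[n]}}) (s : 'S_n) :
    (forall c, rho c%:MP = c%:MP) -> (forall i, rho (hadamardForm i) = hadamardForm (s i)) ->
  forall P, hadamardSubst (msym s P) = rho (hadamardSubst P).
Proof.
move=> rhoC rhoX P.
apply: (eq_mpoly_morph (f := hadamardSubst \o msym s) (g := rho \o hadamardSubst)) => [c|i] /=.
  by rewrite [msym s _]mmapC !hadamardSubstC rhoC.
by rewrite [msym s _]mmapX mmap1U !hadamardSubstX rhoX.
Qed.

Definition signSet (b : 'I_k) (a : 'I_4) : {set 'I_n} :=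
  [set pt (b, r) | r in [pred r | kleinChar a r]].

Lemma mem_signSet b a b' r :
  (pt (b', r) \in signSet b a) = (b' == b) && kleinChar a r.
Proof.
apply/imsetP/andP => [[c ac /pt_inj[-> ->]]|[/eqP-> ar]]; first by rewrite eqxx.
by exists r.
Qed.

(** Bilinearity of the pairing: a shift by [a] in the original variables becomes a
change of sign in the coordinates [c] with [kleinChar a c]. *)
Lemma signChange_hadamardForm b a (s : 'S_n) (f : 'I_4 -> 'I_4) :
    (forall r, s (pt (b, r)) = pt (b, f r)) ->
    (forall i, (forall r, i != pt (b, r)) -> s i = i) ->
    (forall r c, kleinChar (f r) c = kleinChar r c (+) kleinChar a c) ->
  forall i, signChange (signSet b a) (hadamardForm i) = hadamardForm (s i).
Proof.
move=> s_in s_off charf i; case: (blockP i) => [b' r ->|out]; last first.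
  rewrite s_off // !hadamardForm_out // signChangeXi.
  case: imsetP => [[c _ i_c]|_]; last by rewrite scale1r.
  by case/eqP: (out (b, c)).
have [->|b'b] := eqVneq b' b.
  rewrite s_in !hadamardForm_in (raddf_sum (signChange _)) /=; apply: eq_bigr => c _.
  rewrite signChangeZ signChangeXi mem_signSet eqxx scalerA charf signr_addb.
  by [].
rewrite s_off => [|c]; last by apply: contraNneq b'b => /pt_inj[->].
rewrite !hadamardForm_in (raddf_sum (signChange _)) /=; apply: eq_bigr => c _.
by rewrite signChangeZ signChangeXi mem_signSet (negPf b'b) scale1r.
Qed.

(** Since [rot3] is self-adjoint, the 3-cycle on the original variables becomes
the inverse 3-cycle on the coordinates. *)
Lemma msym_hadamardForm b i :
  msym (blockPerm b o1 o3 o1 o2) (hadamardForm i) = hadamardForm (blockPerm b o1 o2 o1 o3 i).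
Proof.
case: (blockP i) => [b' r ->|out]; last first.
  by rewrite blockPerm_off // !hadamardForm_out // [LHS]mmapX mmap1U blockPerm_off.
have [->|b'b] := eqVneq b' b; last first.
  have off c : forall r, pt (b', c) != pt (b, r).
    by move=> d; apply: contraNneq b'b => /pt_inj[->].
  rewrite blockPerm_off // !hadamardForm_in (raddf_sum (msym _)) /=; apply: eq_bigr => c _.
  by rewrite msymZ [msym _ _]mmapX mmap1U blockPerm_off.
rewrite blockPerm_in -/rot3 !hadamardForm_in (raddf_sum (msym _)) /=.
rewrite (reindex_inj (@perm_inj _ rot3)); apply: eq_bigr => c _.
rewrite msymZ [msym _ _]mmapX mmap1U blockPerm_in -kleinChar_rot3; congr (_ *: 'X_(pt (b, _))).
by rewrite !permM !tpermK.
Qed.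

End Blocks.

Arguments hadamardSubst {n k} pt {C} _.
Arguments hadamardForm {n k} pt {C} _.

(** * Roots permuted by the alternating group *)

Lemma natF2 w : w%:R = (odd w)%:R :> 'F_2.
Proof. by elim: w => // w IH; rewrite mulrS IH /=; case: odd; apply: val_inj. Qed.

(** [Y i / q] are the roots of the resolvent, [V] its parameters, and the
polynomials [c j] in the parameters are its coefficients. *)
Section Core.

Variables (C : numFieldType) (n k s m : nat) (pt : 'I_k * 'I_4 -> 'I_n).
Hypothesis pt_inj : injective pt.
Variables (V : 'I_s -> {mpoly C[n]}) (q : {mpoly C[n]}) (Y : 'I_n -> {mpoly C[n]}).
Variable (c : nat -> {mpoly C[s]}).
Hypothesis nz_q : q != 0.
Hypothesis Y_inj : injective Y.
Hypothesis Y_sym : forall (t : 'S_n) i, odd_perm t = false -> msym t (Y i) = Y (t i).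
Let cV j := mmap (@mpolyC n C) V (c j).
Hypothesis Y_root : forall i, \sum_(j < m.+1) cV j * (Y i ^+ j * q ^+ (m - j)) = 0.
Hypothesis Y_simple : forall i,
  \sum_(j < m) cV j.+1 * (Y i ^+ j * q ^+ (m - j.+1)) *+ j.+1 != 0.

Let Z i := hadamardSubst pt (Y i).
(** The sum of the roots of block [b] twisted by the character [d]; the common
denominator [q] is left out, since only quotients of such sums matter. *)
Let E b (d : 'I_4) := \sum_r (-1) ^+ kleinChar d r *: Z (pt (b, r)).

Lemma derivation_Z (D : {mpoly C[n]} -> {mpoly C[n]}) :
    (forall a b, D (a + b) = D a + D b) ->
    (forall a b, D (a * b) = D a * b + a * D b) ->
    (forall a, D a%:MP = 0) -> (forall j, D (hadamardSubst pt (V j)) = 0) ->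
  forall i, hadamardSubst pt q * D (Z i) = Z i * D (hadamardSubst pt q).
Proof.
move=> DD DM DC DV i.
have substE p : hadamardSubst pt (mmap (@mpolyC n C) V p) =
    mmap (hadamardSubst pt \o @mpolyC n C) (hadamardSubst pt \o V) p.
  exact: rmorph_mmap.
apply: (derivation_simple_root DD DM (m := m) (c := fun j => hadamardSubst pt (cV j))).
- move=> j; rewrite /cV substE; apply: (derivation_mmap DD DM) => //= a.
  by rewrite hadamardSubstC.
- have /(congr1 (hadamardSubst pt)) := Y_root i; rewrite rmorph0 rmorph_sum => root.
  rewrite -[RHS]root; apply: eq_bigr => j _.
  by rewrite !rmorphM !rmorphXn.
- apply: contraNneq (Y_simple i) => S0; apply/eqP/(hadamardSubst_inj pt_inj).
  rewrite rmorph0 -[RHS]S0 rmorph_sum; apply: eq_bigr => j _.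
  by rewrite rmorphMn /= !rmorphM !rmorphXn.
Qed.

(** All [E b d / q] are linear combinations of roots of the resolvent, so they are
killed by [D], and so are their quotients. *)
Lemma derivation_E (D : {mpoly C[n]} -> {mpoly C[n]}) :
    (forall a b, D (a + b) = D a + D b) ->
    (forall a b, D (a * b) = D a * b + a * D b) ->
    (forall a, D a%:MP = 0) -> (forall j, D (hadamardSubst pt (V j)) = 0) ->
  forall b d e, D (E b d) * E b e = E b d * D (E b e).
Proof.
move=> DD DM DC DV b.
have qDE d : hadamardSubst pt q * D (E b d) = E b d * D (hadamardSubst pt q).
  rewrite /E (derivation_sum DD) mulr_sumr mulr_suml; apply: eq_bigr => r _.
  rewrite -mul_mpolyC DM DC mul0r add0r mulrCA derivation_Z //.
  by rewrite mulrA.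
move=> d e.
have nz : hadamardSubst pt q != 0.
  by apply: contraNneq nz_q => q0; apply/eqP/(hadamardSubst_inj pt_inj); rewrite q0 rmorph0.
apply: (mulfI nz); rewrite mulrA qDE [RHS]mulrCA qDE mulrAC mulrA.
by rewrite -!mulrA; congr (_ * _); rewrite mulrC.
Qed.

Lemma signChange_E b a (f : 'I_4 -> 'I_4) a1 a2 a3 a4 :
    a1 != a2 -> a3 != a4 -> involutive f ->
    (forall r, (tperm a1 a2 * tperm a3 a4)%g r = f r) ->
    (forall r d, kleinChar (f r) d = kleinChar r d (+) kleinChar a d) ->
  forall b' d, signChange (signSet pt b a) (E b' d)
             = (-1) ^+ ((b' == b) && kleinChar d a) *: E b' d.
Proof.
move=> a12 a34 fK fE charf b' d.
have actZ i : signChange (signSet pt b a) (Z i) = Z (blockPerm pt b a1 a2 a3 a4 i).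
  rewrite /Z -(Y_sym _ (blockPerm_even pt_inj b a12 a34)).
  apply/esym/hadamardSubst_equivariant => [x|j]; first exact: signChangeC.
  apply: (@signChange_hadamardForm _ _ _ pt_inj _ _ _ _ f) => // [r|i' off].
    by rewrite blockPerm_in // fE.
  exact: blockPerm_off.
rewrite /E (raddf_sum (signChange _)) /= scaler_sumr.
have [->|b'b] := eqVneq b' b => /=; last first.
  apply: eq_bigr => r _; rewrite scale1r signChangeZ actZ blockPerm_off // => r'.
  by apply: contraNneq b'b => /pt_inj[->].
rewrite (reindex_inj (inv_inj fK)); apply: eq_bigr => r _.
rewrite signChangeZ actZ blockPerm_in // fE fK scalerA -signr_addb.
by rewrite kleinCharC charf addbC [kleinChar r d]kleinCharC [kleinChar a d]kleinCharC.
Qed.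

Lemma signChange_E1 b b' d : signChange (signSet pt b o1) (E b' d)
  = (-1) ^+ ((b' == b) && odd d) *: E b' d.
Proof.
rewrite (@signChange_E b o1 (kleinShift o1) o0 o1 o2 o3) //.
- by rewrite /kleinChar andbT andbF addbF.
- by move=> r; apply: val_inj; rewrite !kleinShift1E; ord4 r.
- exact: kleinChar_shift1.
Qed.

Lemma signChange_E2 b b' d : signChange (signSet pt b o2) (E b' d)
  = (-1) ^+ ((b' == b) && (1 < d)%N) *: E b' d.
Proof.
rewrite (@signChange_E b o2 (kleinShift o2) o0 o2 o1 o3) //.
- by rewrite /kleinChar andbF andbT.
- by move=> r; apply: val_inj; rewrite !kleinShift2E; ord4 r.
- exact: kleinChar_shift2.
Qed.

(** The 3-cycle of block [b] permutes the three sums [E b d] with [d] nonzero.  It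
acts by a permutation of the coordinates, which preserves degrees. *)
Lemma msym_E b d : msym (blockPerm pt b o1 o3 o1 o2) (E b (rot3 d)) = E b d.
Proof.
have actZ i : msym (blockPerm pt b o1 o3 o1 o2) (Z i) = Z (blockPerm pt b o1 o2 o1 o3 i).
  rewrite /Z -(Y_sym _ (blockPerm_even pt_inj b _ _)) //.
  apply/esym/hadamardSubst_equivariant => [x|j]; first exact: mmapC.
  exact: msym_hadamardForm.
rewrite /E (raddf_sum (msym _)) /= [RHS](reindex_inj (@perm_inj _ rot3)).
apply: eq_bigr => r _.
by rewrite msymZ actZ blockPerm_in // kleinChar_rot3.
Qed.

(** By the 3-cycle the three sums have the same degree and vanish together; if
they did, two roots of the block would coincide, because
[E b o1 + E b o2] is twice the difference of the roots [o0] and [o3]. *)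
Lemma mdeg_E b d : d != o0 ->
  E b d != 0 /\ mdeg (mlead (E b d)) = mdeg (mlead (E b o3)).
Proof.
have msizeE d' : d' != o0 -> msize (E b d') = msize (E b o3).
  have rot d1 d2 : rot3 d1 = d2 -> msize (E b d2) = msize (E b d1).
    by move=> <-; rewrite -[in RHS]msym_E msize_msym.
  have r1 : msize (E b o2) = msize (E b o1) by apply: rot; rewrite rot3E.
  have r2 : msize (E b o3) = msize (E b o2) by apply: rot; rewrite rot3E.
  move=> nz; suff [->//|[->|->]] : d' = o3 \/ d' = o2 \/ d' = o1; rewrite -?r1 -?r2 //.
  by case: d' nz => [[|[|[|[|//]]]] ?] // _; [right; right|right; left|left]; apply: val_inj.
have nzE d' : d' != o0 -> E b d' != 0.
  move=> nz; rewrite -msize_poly_eq0 msizeE //; apply/eqP => E3.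
  have : Z (pt (b, o0)) = Z (pt (b, o3)).
    have E1_0 : E b o1 = 0 by apply/eqP; rewrite -msize_poly_eq0 msizeE // E3.
    have E2_0 : E b o2 = 0 by apply/eqP; rewrite -msize_poly_eq0 msizeE // E3.
    apply: subr0_eq; apply/eqP; have: (Z (pt (b, o0)) - Z (pt (b, o3))) *+ 2 == 0.
      apply/eqP; transitivity (E b o1 + E b o2); last by rewrite E1_0 E2_0 addr0.
      rewrite /E !sum4 /kleinChar /= !expr0 !expr1 !scale1r !scaleN1r; ring.
    by rewrite -mulr_natr mulf_eq0 -mpolyC_nat mpolyC_eq0 pnatr_eq0 orbF.
  by move/(hadamardSubst_inj pt_inj)/Y_inj/pt_inj.
move=> nz; split; first exact: nzE.
by apply: succn_inj; rewrite !mlead_deg ?nzE // msizeE.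
Qed.

(** The rows are a nonconstant parameter over 1 and, for each block,
[E b o3 / E b o2] and [E b o3 / E b o1], which have degree zero and the two
dual characters of the Klein group of the block.  The columns are the total
degree and the weights of the two generators. *)
Lemma klein_bound : (exists j, forall a, V j != a%:MP) -> (k + k < s)%N.
Proof.
case=> j0 nonconst; pose v := hadamardSubst pt (V j0).
have nz_v : v != 0.
  apply: contraNneq (nonconst 0) => v0; apply/eqP/(hadamardSubst_inj pt_inj).
  by rewrite hadamardSubstC -/v v0.
have deg_v : (0 < mdeg (mlead v))%N.
  rewrite lt0n; apply/eqP => deg0.
  have /msize1_polyC vC : (msize v <= 1)%N by rewrite -mlead_deg // deg0.
  by case/eqP: (nonconst v@_0); apply: (hadamardSubst_inj pt_inj); rewrite hadamardSubstC.
(* Rows and columns [1, ..., k] belong to the first generator of the Klein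
   groups, rows and columns [k + 1, ..., 2k] to the second one. *)
pose A (i : 'I_(k + k).+1) := if unlift ord0 i is Some j then
    match split j with inl b => signSet pt b o1 | inr b => signSet pt b o2 end
  else setT.
pose N (i : 'I_(k + k).+1) := if unlift ord0 i is Some j then
    match split j with inl b => E b o3 | inr b => E b o3 end
  else v.
pose M (i : 'I_(k + k).+1) := if unlift ord0 i is Some j then
    match split j with inl b => E b o2 | inr b => E b o1 end
  else 1.
have nzE b d : d != o0 -> E b d != 0 by case/(mdeg_E b).
have odd1 b b' d : d != o0 ->
    odd (wt (signSet pt b o1) (mlead (E b' d))) = (b' == b) && odd d.
  by move=> d0; apply: odd_wt_mlead (nzE _ _ d0) (signChange_E1 _ _ _).
have odd2 b b' d : d != o0 ->
    odd (wt (signSet pt b o2) (mlead (E b' d))) = (b' == b) && (1 < d)%N.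
  by move=> d0; apply: odd_wt_mlead (nzE _ _ d0) (signChange_E2 _ _ _).
apply: (@parameter_bound _ _ s _ (hadamardSubst pt \o V) A N M).
- by move=> i; rewrite /N; case: unliftP => [j _|//]; case: split => b; apply: nzE.
- move=> i; rewrite /M; case: unliftP => [j _|_]; last exact: oner_neq0.
  by case: split => b; apply: nzE.
- apply: det_mod2 => [|i|i j]; rewrite !mxE.
  + rewrite /A /N /M unlift_none !wtT mlead1 mdeg0 subr0.
    by rewrite eqz_nat -lt0n.
  + rewrite /A /N /M unlift_none liftK !wtT; case: split => b;
    by rewrite ?(mdeg_E b (d := o2) isT).2 ?(mdeg_E b (d := o1) isT).2 subrr.
  + rewrite /A /N /M !liftK rmorphB /= -!pmulrn.
    rewrite [X in X - _]natF2 [X in _ - X]natF2 -(inj_eq (can_inj (@splitK k k))) [in RHS]eqE /=.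
    by case: (split i) => b'; case: (split j) => b; rewrite !(odd1, odd2) //;
      rewrite ?andbT ?andbF ?subr0 ?subrr.
- move=> D DD DM DC DV i; rewrite /N /M.
  case: unliftP => [j _|_]; last first.
    by rewrite (derivation1 DM) mulr0 (DV j0) mul0r.
  by case: split => b; apply: derivation_E.
Qed.

End Core.

(** * Algebraic independence of the roots of the general equation *)

Section Roots.

Variables (R : realType) (n : nat) (K : fieldExtType (ratFun R n)).
Variables (L : fieldType) (j : {rmorphism K -> L}) (x : 'I_n -> L).
Hypothesis x_roots :
  map_poly (fun c => j c%:A) (genPoly R n) = \prod_i ('X - (x i)%:P).

Local Notation C := (complex R).
Local Notation polyx := {mpoly C[n]}.

(** The value at the coefficients [a_1, ..., a_n] of the general equation, in
[L]. *)
Definition atCoefs : polyx -> L := j \o (in_alg K \o @tofrac {mpoly C[n]}).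
HB.instance Definition _ := GRing.RMorphism.on atCoefs.

Definition constL : C -> L := atCoefs \o @mpolyC n C.
HB.instance Definition _ := GRing.RMorphism.on constL.

Definition atRoots : polyx -> L := mmap constL x.
HB.instance Definition _ := GRing.RMorphism.on atRoots.

Arguments atCoefs : simpl never.
Arguments constL : simpl never.
Arguments atRoots : simpl never.

Lemma atCoefs_inj : injective atCoefs.
Proof.
move=> P Q /fmorph_inj/fmorph_inj/eqP; rewrite tofrac_eq.
by move/eqP.
Qed.

Lemma atRootsC c : atRoots c%:MP = constL c.
Proof. exact: mmapC. Qed.

Lemma atRootsX i : atRoots 'X_i = x i.
Proof. by rewrite [LHS]mmapX mmap1U. Qed.

Lemma atRootsM P Q : atRoots (P * Q) = atRoots P * atRoots Q.
Proof. exact: rmorphM. Qed.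

Lemma atCoefsX i : atCoefs 'X_i = atRoots ((-1) ^+ i.+1 *: mesym n C i.+1).
Proof.
have lt_i : (n - i.+1 < n)%N by rewrite ltn_subrL (leq_trans _ (ltn_ord i)).
have -> : atCoefs 'X_i = (map_poly (fun c => j c%:A) (genPoly R n))`_(n - i.+1).
  rewrite coef_map_id0 ?scale0r ?rmorph0 //; congr (j _%:A).
  rewrite /genPoly coefD coefXn (ltn_eqF lt_i) add0r coef_sum (bigD1 i) //=.
  rewrite coefZ coefXn eqxx mulr1 big1 ?addr0 // => l li.
  rewrite coefZ coefXn; case: eqP => [eq_il|]; last by rewrite mulr0.
  case/eqP: li; apply: val_inj; have := ltn_ord i; have := ltn_ord l => /=.
  by lia.
rewrite x_roots.
have -> : \prod_i ('X - (x i)%:P) = \prod_(c <- [tuple x i | i < n]) ('X - c%:P).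
  by rewrite big_tuple; apply: eq_bigr => l _; rewrite tnth_mktuple.
have lt_iS : (i.+1 < n.+1)%N by rewrite ltnS.
rewrite (mroots_coeff _ (Ordinal lt_iS)) /=.
rewrite -mul_mpolyC rmorphM /= atRootsC !rmorphXn !rmorphN1; congr (_ * _).
rewrite /mesym !rmorph_sum /=; apply: eq_bigr => h _.
rewrite !rmorph_prod; apply: eq_bigr => l _ /=.
by rewrite atRootsX mevalXU tnth_mktuple.
Qed.

(** Vieta's formulas as a substitution: each coefficient is written as an
elementary symmetric polynomial in the roots, up to sign. *)
Definition coefsToRoots : polyx -> polyx :=
  comp_mpoly [tuple (-1) ^+ i.+1 *: mesym n C i.+1 | i < n].
HB.instance Definition _ := GRing.RMorphism.on coefsToRoots.

Arguments coefsToRoots : simpl never.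

Lemma coefsToRootsC c : coefsToRoots c%:MP = c%:MP.
Proof. exact: comp_mpolyC. Qed.

Lemma coefsToRootsZ c P : coefsToRoots (c *: P) = c *: coefsToRoots P.
Proof. exact: comp_mpolyZ. Qed.

Lemma coefsToRootsX i : coefsToRoots 'X_i = (-1) ^+ i.+1 *: mesym n C i.+1.
Proof. by rewrite /coefsToRoots comp_mpolyXU -tnth_nth tnth_mktuple. Qed.

Lemma atRoots_coefs P : atRoots (coefsToRoots P) = atCoefs P.
Proof.
apply: (eq_mpoly_morph (f := atRoots \o coefsToRoots) (g := atCoefs)) => [c|i] /=.
  by rewrite coefsToRootsC atRootsC.
by rewrite coefsToRootsX atCoefsX.
Qed.

Lemma msym_coefsToRoots t P : msym t (coefsToRoots P) = coefsToRoots P.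
Proof.
apply: (eq_mpoly_morph (f := msym t \o coefsToRoots) (g := coefsToRoots)) => [c|i] /=.
  by rewrite coefsToRootsC [LHS]mmapC.
by rewrite coefsToRootsX msymZ (issymP _ (mesym_sym _ _ _)).
Qed.

(** The norm of a polynomial that vanishes at the roots is symmetric, hence a
polynomial in the coefficients that vanishes at [a_1, ..., a_n].  These are
independent variables, so the norm is zero. *)
Lemma atRoots_inj : injective atRoots.
Proof.
suff ker P : atRoots P = 0 -> P = 0.
  by move=> P Q /eqP; rewrite -subr_eq0 -rmorphB => /eqP/ker/subr0_eq.
move=> P0; pose N := \prod_(t : 'S_n) msym t P.
have symN : N \is symmetric.
  apply/issymP => t; rewrite /N rmorph_prod [RHS](reindex_inj (mulIg t)) /=.
  by apply: eq_bigr => u _; rewrite msymMm.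
have N0 : atRoots N = 0.
  rewrite /N (bigD1 1%g) //= msym1m.
  by rewrite atRootsM P0 mul0r.
have [T [NT _]] := sym_fundamental symN.
(* [T] has the elementary symmetric polynomials as arguments, while the
   coefficients are these polynomials up to alternating signs. *)
pose T' := T \mPo [tuple (-1) ^+ i.+1 *: 'X_i | i < n].
have T'N : coefsToRoots T' = N.
  rewrite -NT; apply: (eq_mpoly_morph (f := coefsToRoots \o comp_mpoly _)
    (g := comp_mpoly _)) => [c|i] /=.
    by rewrite !comp_mpolyC coefsToRootsC.
  rewrite !comp_mpolyXU -!tnth_nth !tnth_mktuple coefsToRootsZ.
  by rewrite coefsToRootsX scalerA -exprMn mulrNN mulr1 expr1n scale1r.
have T'0 : T' = 0 by apply: atCoefs_inj; rewrite -atRoots_coefs T'N N0 rmorph0.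
move: T'N; rewrite T'0 rmorph0 => /esym/eqP; rewrite prodf_seq_eq0.
case/hasP => t _ /= /eqP tP0; apply: (@inj_msym _ _ t); rewrite tP0.
by rewrite msym0.
Qed.

(** * Elements of K as even-symmetric fractions in the roots *)

Definition evenSym (P : polyx) := forall t : 'S_n, odd_perm t = false -> msym t P = P.

Lemma evenSymC c : evenSym c%:MP.
Proof. by move=> t _; apply: mmapC. Qed.

Lemma evenSymD P Q : evenSym P -> evenSym Q -> evenSym (P + Q).
Proof. by move=> sP sQ t et; rewrite msymD sP ?sQ. Qed.

Lemma evenSymM P Q : evenSym P -> evenSym Q -> evenSym (P * Q).
Proof. by move=> sP sQ t et; rewrite msymM sP ?sQ. Qed.

Lemma evenSym_prod I (r : seq I) (p : pred I) (F : I -> polyx) :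
  (forall i, evenSym (F i)) -> evenSym (\prod_(i <- r | p i) F i).
Proof.
move=> sF; elim/big_ind: _ => //; first by move=> t _; apply: msym1.
by move=> *; apply: evenSymM.
Qed.

Definition vandermonde : polyx := \det (Vandermonde n (\row_i 'X_i)).

Lemma msym_vandermonde t : msym t vandermonde = (-1) ^+ t * vandermonde.
Proof.
rewrite /vandermonde -det_map_mx mulrC -odd_permV -det_perm -det_mulmx -col_permE.
congr (\det _); apply/matrixP => i l; rewrite !mxE rmorphXn /=; congr (_ ^+ _).
by rewrite [LHS]mmapX mmap1U.
Qed.

Lemma evenSym_vandermonde : evenSym vandermonde.
Proof. by move=> t et; rewrite msym_vandermonde et expr0 mul1r. Qed.

Lemma atRoots_vandermonde : atRoots vandermonde ^+ 2 = prodSqDiff x.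
Proof.
rewrite /vandermonde det_Vandermonde /prodSqDiff.
rewrite rmorph_prod -prodrXl; apply: eq_bigr => i _.
rewrite rmorph_prod -prodrXl; apply: eq_bigr => l _.
rewrite rmorphB /= !mxE !atRootsX.
by rewrite -sqrrN opprB.
Qed.

Variables (D : polyx) (z : K).
Hypothesis D_disc : j (tofrac D)%:A = prodSqDiff x.
Hypothesis z_sq : z ^+ 2 = (tofrac D)%:A.
Hypothesis K_gen : (<<1; z>> = fullv)%VS.

Lemma sqrt_disc : exists2 d, evenSym d & j z = atRoots d.
Proof.
have : j z ^+ 2 == atRoots vandermonde ^+ 2.
  by rewrite -rmorphXn z_sq D_disc atRoots_vandermonde.
rewrite eqf_sqr => /orP[]/eqP ->.
  by exists vandermonde => //; apply: evenSym_vandermonde.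
exists (- vandermonde) => [t et|]; last by rewrite rmorphN.
by rewrite msymN evenSym_vandermonde.
Qed.

Definition evenSymFrac (u : L) := exists2 Q, Q != 0 /\ evenSym Q &
  exists2 P, evenSym P & u * atRoots Q = atRoots P.

Lemma evenSymFracD u w : evenSymFrac u -> evenSymFrac w -> evenSymFrac (u + w).
Proof.
case=> [Q [nzQ sQ] [P sP uQ]] [Q' [nzQ' sQ'] [P' sP' wQ']].
exists (Q * Q'); first by split; [rewrite mulf_neq0 | apply: evenSymM].
exists (P * Q' + P' * Q); first by apply: evenSymD; apply: evenSymM.
by rewrite rmorphD /= !atRootsM -uQ -wQ'; ring.
Qed.

Lemma evenSymFracM u w : evenSymFrac u -> evenSymFrac w -> evenSymFrac (u * w).
Proof.
case=> [Q [nzQ sQ] [P sP uQ]] [Q' [nzQ' sQ'] [P' sP' wQ']].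
exists (Q * Q'); first by split; [rewrite mulf_neq0 | apply: evenSymM].
exists (P * P'); first exact: evenSymM.
by rewrite !atRootsM -uQ -wQ' mulrACA.
Qed.

Lemma evenSymFrac_poly P : evenSym P -> evenSymFrac (atRoots P).
Proof.
move=> sP; exists 1; last by exists P => //; rewrite [X in _ * X]rmorph1 mulr1.
by split; [apply: oner_neq0 | move=> t _; apply: msym1].
Qed.

(** [K] is generated by [z], a square root of the discriminant, which is up to sign
the Vandermonde determinant of the roots. *)
Lemma evenSymFrac_K (a : K) : evenSymFrac (j a).
Proof.
have : a \in <<1; z>>%VS by rewrite K_gen memvf.
case/Fadjoin_polyP => p /polyOverP p1 ->.
rewrite horner_coef rmorph_sum; elim/big_ind: _.
- by rewrite -(rmorph0 atRoots); apply: evenSymFrac_poly; rewrite -mpolyC0; apply: evenSymC.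
- exact: evenSymFracD.
move=> i _; rewrite rmorphM /=; apply: evenSymFracM.
  have /vlineP[c ->] := p1 i.
  have [b nzb [e cb]] := frac_denom c.
  exists (coefsToRoots b).
    split; last by move=> t _; apply: msym_coefsToRoots.
    apply: contraNneq nzb => b0; apply/eqP/atCoefs_inj.
    by rewrite -atRoots_coefs b0 !rmorph0.
  exists (coefsToRoots e); first by move=> t _; apply: msym_coefsToRoots.
  have inL : j c%:A * atCoefs b = atCoefs e.
    have inK : in_alg K c * in_alg K (tofrac b) = in_alg K (tofrac e).
      by rewrite -rmorphM cb.
    exact: etrans (esym (rmorphM j _ _)) (congr1 j inK).
  apply: etrans (congr1 (GRing.mul _) (atRoots_coefs b)) _.
  exact: etrans inL (esym (atRoots_coefs e)).
rewrite rmorphXn; have [d sd ->] := sqrt_disc.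
rewrite -rmorphXn; apply: evenSymFrac_poly => t et.
by rewrite rmorphXn /= sd.
Qed.

HB.instance Definition _ := GRing.RMorphism.copy (@constK R n K)
  (in_alg K \o (@tofrac {mpoly C[n]} \o @mpolyC n C)).

HB.instance Definition _ (m : nat) (w : 'I_m -> K) :=
  GRing.RMorphism.copy (evalK w) (mmap (@constK R n K) w).

Lemma entireRational_atRoots (w : K) :
  entireRational z w -> exists P, j w = atRoots P.
Proof.
have [d _ jz] := sqrt_disc.
pose W (i : 'I_n.+1) := if unlift ord_max i is Some l then coefsToRoots 'X_l else d.
case=> P ->; exists (mmap (@mpolyC n C) W P).
have jW i : j (parsOf z i) = atRoots (W i).
  by rewrite /parsOf /W; case: unlift => [l|//]; rewrite atRoots_coefs.
transitivity (mmap (atRoots \o @mpolyC n C) (atRoots \o W) P).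
  rewrite /evalK /mmap rmorph_sum; apply: eq_bigr => m _; rewrite rmorphM.
  congr (_ * _); first by rewrite /= atRootsC.
  by rewrite /mmap1 rmorph_prod; apply: eq_bigr => i _; rewrite rmorphXn jW.
exact/esym/rmorph_mmap.
Qed.

Variables (s : nat) (v : 'I_s -> K) (g : {poly K}).

(** * Resolvents *)

Lemma rational_common_denom (m : nat) (f : 'I_m.+1 -> K) :
    (forall i, rationalIn v (f i)) ->
  exists2 B : K, B != 0 &
    exists c : nat -> {mpoly C[s]}, forall i : 'I_m.+1, evalK v (c i) = f i * B.
Proof.
move=> /fin_all_exists[P /fin_all_exists[Q PQ]].
have evalM a b : evalK v (a * b) = evalK v a * evalK v b.
  exact: rmorphM.
have eval_prod (p : pred 'I_m.+1) :
    evalK v (\prod_(i | p i) Q i) = \prod_(i | p i) evalK v (Q i).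
  exact: rmorph_prod.
exists (\prod_i evalK v (Q i)).
  by apply/prodf_neq0 => i _; have [] := PQ i.
exists (fun i => P (inord i) * \prod_(l | l != inord i) Q l) => i.
rewrite inord_val evalM eval_prod [in RHS](bigD1 i) //= mulrA; congr (_ * _).
by have [nzQ ->] := PQ i; rewrite divfK.
Qed.

Hypothesis g_res : rationalResolvent z j x v g.

(** [C] is algebraically closed. *)
Lemma root_constL (G : {poly C}) (u : L) :
  G != 0 -> root (map_poly constL G) u -> exists r, u = constL r.
Proof.
move=> nzG; have [rs ->] := closed_field_poly_normal G.
rewrite map_polyZ /= rootZ; last by rewrite fmorph_eq0 lead_coef_eq0.
rewrite rmorph_prod /=.
under eq_bigr => r _ do rewrite rmorphB /= map_polyX map_polyC.
rewrite -(big_map constL xpredT (fun r => 'X - r%:P)) root_prod_XsubC.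
by case/mapP => r _ ->; exists r.
Qed.

(** Everything is transported to [C[x]], where [klein_bound] applies.  If all
parameters were constant, then so would be all roots of the resolvent, but an
even permutation moves the first root. *)
Lemma resolvent_bound k (pt : 'I_k * 'I_4 -> 'I_n) :
  (2 < n)%N -> injective pt -> (k + k < s)%N.
Proof.
move=> n_gt2 pt_inj.
have [v_entire g_rat size_g [y [alpha [g_prod y_inj yE]]]] := g_res.
have /fin_all_exists[V jV] := fun i => entireRational_atRoots (v_entire i).
have [B nzB [c cB]] := rational_common_denom (fun i : 'I_n.+1 => g_rat i).
have /fin_all_exists2[Q sQ /fin_all_exists2[P sP PQ]] := fun i => evenSymFrac_K (alpha i).
pose q := \prod_l Q l.
pose Y i := \sum_l P l * (\prod_(m | m != l) Q m) * 'X_i ^+ l.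
have nz_q : q != 0 by apply/prodf_neq0 => l _; have [] := sQ l.
have sym_q : evenSym q by apply: evenSym_prod => l; have [] := sQ l.
have Yq i : atRoots (Y i) = y i * atRoots q.
  rewrite yE mulr_suml rmorph_sum; apply: eq_bigr => l _ /=.
  rewrite !atRootsM -PQ rmorphXn /= atRootsX /q [in RHS](bigD1 l) //= atRootsM.
  by ring.
have nz_aq : atRoots q != 0.
  by apply: contraNneq nz_q => q0; apply/eqP/atRoots_inj; rewrite q0 rmorph0.
have Y_inj : injective Y.
  by move=> i i' YY; apply/y_inj/(mulIf nz_aq); rewrite -!Yq YY.
have Y_sym t i : odd_perm t = false -> msym t (Y i) = Y (t i).
  move=> et; rewrite /Y rmorph_sum; apply: eq_bigr => l _ /=.
  rewrite !msymM rmorphXn /= (sP l t et); congr (_ * _ * _ ^+ _).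
    by apply: evenSym_prod => // m; have [] := sQ m.
  by rewrite [LHS]mmapX mmap1U.
pose cV i := mmap (@mpolyC n C) V (c i).
have cVE (i : 'I_n.+1) : atRoots (cV i) = j g`_i * j B.
  rewrite -rmorphM -cB.
  transitivity (mmap (atRoots \o @mpolyC n C) (atRoots \o V) (c i)).
    exact: rmorph_mmap.
  rewrite /evalK /mmap rmorph_sum; apply: eq_bigr => m _; rewrite rmorphM.
  congr (_ * _); first by rewrite /= atRootsC.
  by rewrite /mmap1 rmorph_prod; apply: eq_bigr => l _; rewrite rmorphXn jV.
pose gL := map_poly j g.
have size_gL : size gL = n.+1 by rewrite size_map_poly.
have gL_root i : gL.[y i] = 0.
  rewrite /gL g_prod hornerZ horner_prod (bigD1 i) //= hornerXsubC subrr.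
  by rewrite mul0r mulr0.
have gL_simple i : gL^`().[y i] != 0.
  rewrite /gL g_prod derivZ hornerZ mulf_neq0 //.
    by rewrite fmorph_eq0 lead_coef_eq0 -size_poly_eq0 size_g.
  rewrite (bigD1 i) //= derivM derivXsubC mul1r hornerD hornerM hornerXsubC.
  rewrite subrr mul0r addr0 horner_prod; apply/prodf_neq0 => l li.
  by rewrite hornerXsubC subr_eq0 (inj_eq y_inj) eq_sym.
have Y_root i : \sum_(l < n.+1) cV l * (Y i ^+ l * q ^+ (n - l)) = 0.
  apply: atRoots_inj; rewrite rmorph0 rmorph_sum.
  transitivity (j B * atRoots q ^+ n * gL.[y i]); last by rewrite gL_root mulr0.
  rewrite (horner_coef_wide _ (eq_leq size_gL)) mulr_sumr; apply: eq_bigr => l _ /=.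
  rewrite !atRootsM cVE !rmorphXn /= Yq coef_map exprMn.
  have -> : atRoots q ^+ n = atRoots q ^+ (n - l) * atRoots q ^+ l.
    by rewrite -exprD subnK ?leq_ord.
  by ring.
have Y_simple i : \sum_(l < n) cV l.+1 * (Y i ^+ l * q ^+ (n - l.+1)) *+ l.+1 != 0.
  suff : atRoots (\sum_(l < n) cV l.+1 * (Y i ^+ l * q ^+ (n - l.+1)) *+ l.+1) != 0.
    by apply: contraNneq => ->; rewrite rmorph0.
  suff -> : atRoots (\sum_(l < n) cV l.+1 * (Y i ^+ l * q ^+ (n - l.+1)) *+ l.+1)
         = j B * atRoots q ^+ n.-1 * gL^`().[y i].
    by rewrite !mulf_neq0 ?expf_neq0 ?fmorph_eq0.
  have size_dg : (size gL^`() <= n)%N.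
    by rewrite -ltnS -size_gL lt_size_deriv // -size_poly_eq0 size_gL.
  rewrite (horner_coef_wide _ size_dg) mulr_sumr rmorph_sum; apply: eq_bigr => l _.
  have lS : (l.+1 < n.+1)%N by rewrite ltnS.
  rewrite rmorphMn /= !atRootsM (cVE (Ordinal lS)) !rmorphXn /= Yq coef_deriv.
  rewrite coef_map /= exprMn mulrnAl mulrnAr; congr (_ *+ _).
  have -> : atRoots q ^+ n.-1 = atRoots q ^+ (n - l.+1) * atRoots q ^+ l.
    by rewrite -exprD; congr (_ ^+ _); have := ltn_ord l; lia.
  by ring.
apply: (klein_bound pt_inj nz_q Y_inj Y_sym Y_root Y_simple).
case: (pickP (fun i => V i != ((V i)@_(0%MM))%:MP)) => [i Vi|V_const].
  by exists i => a; apply: contraNneq Vi => ->; rewrite mcoeffC eqxx mulr1.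
have {}V_const i : V i = ((V i)@_(0%MM))%:MP by apply/eqP/negbFE/V_const.
pose a i := (V i)@_(0%MM).
have cV_const l : cV l = ((c l).@[a])%:MP.
  rewrite /cV /meval /mmap rmorph_sum; apply: eq_bigr => m _.
  rewrite rmorphM; congr (_ * _); rewrite /mmap1 rmorph_prod.
  by apply: eq_bigr => i _; rewrite rmorphXn V_const.
pose G := \poly_(l < n.+1) (c l).@[a].
have GL : map_poly constL G = j B *: gL.
  apply/polyP => l; rewrite coefZ coef_map coef_poly.
  case: ltnP => [lt_l|le_l]; last first.
    by rewrite raddf0 nth_default ?size_gL ?mulr0.
  transitivity (atRoots (cV l)); first by rewrite cV_const atRootsC.
  by rewrite (cVE (Ordinal lt_l)) coef_map mulrC.
have nzG : G != 0.
  rewrite -(map_poly_eq0 constL) GL scaler_eq0 fmorph_eq0 (negPf nzB) /=.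
  by rewrite -size_poly_eq0 size_gL.
have Y_prop i : exists r : C, Y i = r%:MP * q.
  have [|r yr] := @root_constL G (y i) nzG.
    by rewrite GL rootE hornerZ gL_root mulr0.
  by exists r; apply: atRoots_inj; rewrite Yq atRootsM atRootsC yr.
pose i0 : 'I_n := Ordinal (ltn_trans (ltn_trans (ltn0Sn 0) (ltnSn 1)) n_gt2).
pose i1 : 'I_n := Ordinal (ltn_trans (ltnSn 1) n_gt2).
pose i2 : 'I_n := Ordinal n_gt2.
pose t : 'S_n := (tperm i0 i1 * tperm i1 i2)%g.
have even_t : odd_perm t = false by rewrite odd_permM !odd_tperm.
have [r Yr] := Y_prop i0.
have : Y (t i0) = Y i0.
  rewrite -Y_sym // Yr msymM (sym_q t even_t); congr (_ * _); exact: mmapC.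
by move/Y_inj; rewrite permM tpermL tpermL => /(congr1 val).
Qed.

End Roots.

Lemma quarter_lt n (p : 'I_(n %/ 4) * 'I_4) : (4 * p.1 + p.2 < n)%N.
Proof. by case: p => [[b ltb] [r ltr]] /=; lia. Qed.

Lemma quarter_inj n : injective (fun p => Ordinal (@quarter_lt n p)).
Proof.
move=> [b r] [b' r'] /(congr1 val) /= eq_br.
have [ltr ltr'] := (ltn_ord r, ltn_ord r').
by congr (_, _); apply: val_inj => /=; lia.
Qed.

Theorem mainTheorem7 (R : realType) (n : nat) (n_ge2 : (2 <= n)%N)
  (K : fieldExtType (ratFun R n))
  (* L is an algebraic closure of K *)
  (L : closedFieldType) (j : {rmorphism K -> L})
  (L_alg : forall u : L, algebraicOver j u)
  (* x_1, ..., x_n are the roots of f *)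
  (x : 'I_n -> L)
  (x_roots : map_poly (fun c => j c%:A) (genPoly R n) = \prod_i ('X - (x i)%:P))
  (* D(a_1, ..., a_n) is the discriminant of f *)
  (D : {mpoly (complex R)[n]})
  (D_disc : j (tofrac D)%:A = prodSqDiff x)
  (* K = C(a_1, ..., a_n, z) with z^2 = D(a_1, ..., a_n) *)
  (z : K) (z_sq : z ^+ 2 = (tofrac D)%:A)
  (K_gen : (<<1; z>> = fullv)%VS)
  (* a rational resolvent with s parameters *)
  (s : nat) (v : 'I_s -> K) (g : {poly K})
  (g_res : rationalResolvent z j x v g) :
  ((n - 1) %/ 2 <= s)%N.

Proof.
have [n_gt2|n_le2] := ltnP 2 n; last first.
  by rewrite (_ : n = 2%N) //; lia.
have := resolvent_bound x_roots D_disc z_sq K_gen g_res n_gt2 (@quarter_inj n).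
by move: n_gt2; clear; lia.
Qed.
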